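(* $f(m)\leq \frac{(m-1)(m-2\sqrt{m})}{8}$.
   Context: For a graph $G$, $\lambda(G)$ denotes the spectral radius of $G$. $f(m)$ denotes the minimum number of copies of 4-cycles over all labelled graphs $G$ on $m$ edges with $\lambda(G)>\sqrt{m}$.
   Formalization: The bound is stated for m ≥ 4 only: for m = 3 it fails (the triangle gives f(3) = 0, while the right side is negative), and for m ≤ 2 no graph on m edges has λ(G) > √m, so f(m) is undefined. *)

(* Defs.v *)
From HB Require Import structures.
From mathcomp Require Import all_boot all_order all_algebra.
From mathcomp Require Import classical_sets reals.
From mathcomp Require Import complex.

Set Implicit Arguments.
Unset Strict Implicit.
Unset Printing Implicit Defensive.

Import Order.TTheory GRing.Theory Num.Theory.
Local Open Scope ring_scope.

Record sgraph (n : nat) := SGraph {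
  adj :> rel 'I_n;
  adj_sym : symmetric adj;
  adj_irrefl : irreflexive adj }.

Definition edges n (G : sgraph n) : {set {set 'I_n}} :=
  [set [set p.1; p.2]%SET | p : 'I_n * 'I_n & G p.1 p.2]%SET.

Definition adjacency (K : nzRingType) n (G : sgraph n) : 'M[K]_n :=
  \matrix_(i, j) (G i j)%:R.

(* The set below is finite, and nonempty as soon as [0 < n], so that [sup] is
   then a maximum; for the graph without vertices the value is [sup set0 = 0]. *)
Definition spectral_radius (R : realType) n (G : sgraph n) : R :=
  sup [set Normc.normc z | z in
         [set z : R[i] | eigenvalue (adjacency R[i] G) z]]%classic.

Definition cycle_edges n (t : 4.-tuple 'I_n) : {set {set 'I_n}} :=
  [set [set tnth t i; tnth t (ordS i)]%SET | i : 'I_4]%SET.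

(* A copy is a subgraph, given by its edge set: the eight closed walks around
   the same 4-cycle are counted once. *)
Definition C4_copies n (G : sgraph n) : {set {set {set 'I_n}}} :=
  [set cycle_edges t | t : 4.-tuple 'I_n & ucycleb G t]%SET.

(* The labelled graphs range over the vertex sets ['I_n] for all [n], isolated
   vertices being allowed. *)
Definition C4_counts (R : realType) (m : nat) : set nat :=
  [set k | exists n (G : sgraph n),
     [/\ #|edges G| = m, Num.sqrt (m%:R : R) < spectral_radius R G
       & #|C4_copies G| = k]]%classic.

(* [is_f R m k] is "f(m) = k".  The function f is rendered by its graph because
   the minimum does not exist when no graph qualifies, which is the case for [m <= 2]. *)
Definition is_f (R : realType) (m k : nat) : Prop :=
  C4_counts R m k /\ (forall l, C4_counts R m l -> (k <= l)%N).

(* Main.v *)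
Require Import Defs.
From mathcomp Require Import all_boot all_order all_algebra.
From mathcomp Require Import reals.
From mathcomp Require Import complex.
From mathcomp Require Import zify ring lra.

(** Let [s] be the square root of [m] and [q] its integer part, so [2 <= q].
    The bound is witnessed by the pineapple graph made of a complete graph on
    [q + 1] vertices and of [r = m - 'C(q + 1, 2)] pendant edges, all attached
    to the same vertex of the complete graph.

    A 4-cycle avoids the pendant vertices, because these have degree one, so
    the graph has at most (in fact exactly)
    [3 * 'C(q + 1, 4) = (q + 1) * q * (q - 1) * (q - 2) / 8] copies of the
    4-cycle ([C4_copies_pineapple]).  As [2 <= q <= s], this is at most
    [(s + 1) * s * (s - 1) * (s - 2) / 8 = (m - 1) * (m - 2 * s) / 8].

    On the spectral side, a number [x] other than [0] and [q - 1] is an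
    eigenvalue, with an eigenvector constant on each of the three kinds of
    vertices (the hub, the rest of the complete graph, the pendant vertices),
    as soon as it is a root of the cubic polynomial
    [p = x^2 * (x - (q - 1)) - q * x - r * (x - (q - 1))]
    ([pineapple_eigenvalue]).  Substituting [s^2 = 'C(q + 1, 2) + r] gives
    [p(s) = - (q / 2) * (q - 1) * (q + 1 - s)], which is negative because
    [1 < q] and [s < q + 1], whereas [p(q + r)] is nonnegative; hence [p] has a
    root above [s], and the spectral radius exceeds [s]
    ([pineapple_spectral_radius]).

    Since some graph qualifies, the minimum defining [f] exists and is bounded
    by the count for that graph ([is_f_le]). *)

Set Implicit Arguments.
Unset Strict Implicit.
Unset Printing Implicit Defensive.

Import Order.TTheory GRing.Theory Num.Theory.
Local Open Scope ring_scope.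

(** * Spectral radius *)

Lemma spectral_radius_ge (R : realType) n (G : sgraph n) (x : R) :
  0 <= x -> eigenvalue (adjacency R[i] G) (x%:C)%C -> x <= spectral_radius R G.
Proof.
move=> x0 xG; apply: ub_le_sup.
  (* The eigenvalues are the roots of the characteristic polynomial, so the sum
     of the moduli of all roots is an upper bound. *)
  have [rs rsE] := closed_field_poly_normal (char_poly (adjacency R[i] G)).
  exists (\sum_(z <- rs) Normc.normc z) => _ [z /= zG <-].
  have zrs : z \in rs.
    move: zG; rewrite eigenvalue_root_char rsE.
    by rewrite (monicP (char_poly_monic _)) scale1r root_prod_XsubC.
  rewrite (big_rem z zrs) /= lerDl sumr_ge0 // => -[a b] _.
  exact: sqrtr_ge0.
exists (x%:C)%C => //.
by rewrite /= expr0n /= addr0 sqrtr_sqr ger0_norm.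
Qed.

(** * Pineapple graphs *)

(** Adjacency in the pineapple graph: the vertices [0, ..., q] form a complete
    graph and the vertices [q + 1, ..., q + r] are joined to the hub [0] only. *)
Definition pineapple_adj q r (i j : 'I_(q + r).+1) : bool :=
  (i != j) && [|| i == ord0, j == ord0 | (i <= q)%N && (j <= q)%N].

Lemma pineapple_adj_sym q r : symmetric (@pineapple_adj q r).
Proof.
by move=> i j; rewrite /pineapple_adj eq_sym orbCA [(j <= q)%N && _]andbC.
Qed.

Lemma pineapple_adj_irrefl q r : irreflexive (@pineapple_adj q r).
Proof. by move=> i; rewrite /pineapple_adj eqxx. Qed.

(** The complete graph on [q + 1] vertices with [r] pendant edges at one vertex. *)
Definition pineapple q r : sgraph (q + r).+1 :=
  SGraph (@pineapple_adj_sym q r) (@pineapple_adj_irrefl q r).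

(** The vertices of the complete graph inside [pineapple q r]. *)
Definition core q r : {set 'I_(q + r).+1} := [set i : 'I_(q + r).+1 | (i <= q)%N]%SET.

Lemma card_core q r : #|core q r| = q.+1.
Proof.
have le_q : (q.+1 <= (q + r).+1)%N by rewrite ltnS leq_addr.
have widen_inj : injective (widen_ord le_q) by move=> i j [/val_inj].
rewrite -[RHS]card_ord -(card_imset _ widen_inj).
apply: eq_card => i; rewrite inE; apply/idP/imsetP => [iq|[j _ ->]] /=.
  by exists (Ordinal (iq : (i < q.+1)%N)) => //; apply: val_inj.
by rewrite -ltnS ltn_ord.
Qed.

Lemma pineapple_pendant q r (i j : 'I_(q + r).+1) :
  i \notin core q r -> pineapple q r i j -> j = ord0.
Proof.
rewrite inE /= => iq /andP[_]; case/or3P => [/eqP i0|/eqP //|/andP[le_iq]].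
  by rewrite i0 in iq.
by rewrite le_iq in iq.
Qed.

Lemma edges_pineapple q r :
  edges (pineapple q r) =
    ([set B : {set 'I_(q + r).+1} | (B \subset core q r) && (#|B| == 2%N)]
     :|: [set [set ord0; i] | i in ~: core q r])%SET.
Proof.
apply/setP => B; apply/imsetP/idP => [[[i j]] | ].
  rewrite inE => Gij ->; have {}Gij : pineapple q r i j by [].
  rewrite !inE /=.
  have [ic|ic] := boolP (i \in core q r); last first.
    rewrite (pineapple_pendant ic Gij) setUC; apply/orP; right.
    by apply: imset_f; rewrite inE.
  have [jc|jc] := boolP (j \in core q r); last first.
    move: Gij; rewrite adj_sym => /(pineapple_pendant jc)->.
    by apply/orP; right; apply: imset_f; rewrite inE.
  case/andP: Gij => ij _.
  by rewrite subUset !sub1set ic jc cards2 ij.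
rewrite in_setU => /orP[|Bi].
  rewrite inE => /andP[sB /cards2P[i [j [ij BE]]]].
  exists (i, j) => //=; rewrite inE /= /pineapple_adj ij /=.
  move: sB; rewrite BE subUset !sub1set !inE => /andP[-> ->].
  by rewrite !orbT.
have [i iq ->] := imsetP Bi; exists (ord0, i) => //.
rewrite inE /= /pineapple_adj eqxx andbT eq_sym.
by apply: contraTneq iq => ->; rewrite !inE.
Qed.

Lemma card_edges_pineapple q r : #|edges (pineapple q r)| = ('C(q.+1, 2) + r)%N.
Proof.
have ord0c : ord0 \in core q r by rewrite inE.
rewrite edges_pineapple cardsU cards_draws card_core.
rewrite (_ : _ :&: _ = set0)%SET; last first.
  apply/setP => B; rewrite !inE; apply/negP => /andP[/andP[sB _]].
  case/imsetP => i; rewrite inE => /negP ic BE.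
  by apply: ic; apply: (subsetP sB); rewrite BE set22.
rewrite cards0 subn0 card_in_imset; last first.
  move=> i j; rewrite !inE => ic jc /setP/(_ i); rewrite set22 !inE.
  by case/esym/orP=> /eqP// i0; rewrite i0 in ic.
by rewrite cardsCs setCK card_core card_ord subSS addKn.
Qed.

(** * Spectral radius of pineapple graphs *)

(** The eigenvector takes the value [x * (x - (q - 1))] at the hub, [x] on the
    rest of the complete graph and [x - (q - 1)] on the pendant vertices; the
    second hypothesis is the eigenvalue equation at the hub. *)
Lemma pineapple_eigenvalue (K : fieldType) q r (x : K) :
    x * (x - (q%:R - 1)) != 0 ->
    x ^+ 2 * (x - (q%:R - 1)) = q%:R * x + r%:R * (x - (q%:R - 1)) ->
  eigenvalue (adjacency K (pineapple q r)) x.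
Proof.
set y := x - (q%:R - 1) => xy0 xE.
pose v : 'rV[K]_(q + r).+1 := \row_i
  (if i == ord0 then x * y else if (i <= q)%N then x else y).
have v0 : v ord0 ord0 = x * y by rewrite mxE.
have vl (i : 'I_q) : v ord0 (lift ord0 (lshift r i)) = x.
  by rewrite mxE /= /bump /= add1n ltn_ord.
have vr (i : 'I_r) : v ord0 (lift ord0 (rshift q i)) = y.
  by rewrite mxE /= /bump /= add1n ltnNge leq_addr.
apply/eigenvalueP; exists v; last first.
  by apply: contra xy0 => /eqP v_0; rewrite -v0 v_0 mxE.
apply/rowP => j; rewrite [RHS]mxE mxE.
rewrite big_ord_recl big_split_ord /= v0.
under eq_bigr => i _ do rewrite vl.
under [X in _ + (_ + X)]eq_bigr => i _ do rewrite vr.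
have [->|[k ->]] : j = ord0 \/ exists k, j = lift ord0 k.
  by have [k ->|->] := unliftP ord0 j; [right; exists k | left].
- under eq_bigr => i _ do rewrite mxE /= /pineapple_adj /= mulr1.
  under [X in _ + (_ + X)]eq_bigr => i _ do rewrite mxE /= /pineapple_adj /= mulr1.
  rewrite v0 mxE adj_irrefl mulr0 add0r !sumr_const !card_ord.
  by rewrite -[x *+ q]mulr_natl -[y *+ r]mulr_natl -xE; ring.
- case: (split_ordP k) => {}k ->.
  + have A (i : 'I_q) : x * adjacency K (pineapple q r)
        (lift ord0 (lshift r i)) (lift ord0 (lshift r k)) = x - x * (i == k)%:R.
      rewrite mxE /= /pineapple_adj (inj_eq lift_inj) (inj_eq (@lshift_inj _ _)).
      rewrite /= /bump /= !add1n !ltn_ord /=.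
      by case: (i == k); rewrite /= ?mulr1 ?mulr0 ?subr0 ?subrr.
    under eq_bigr => i _ do rewrite A.
    rewrite sumrB sumr_const card_ord (bigD1 k) //= eqxx.
    rewrite big1 => [|i /negbTE->]; last by rewrite mulr0.
    rewrite big1 => [|i _]; last first.
      rewrite mxE /= /pineapple_adj /= /bump /= !add1n [(q + i < q)%N]ltnNge.
      by rewrite leq_addr /= andbF mulr0.
    rewrite vl mxE /= /pineapple_adj /= mulr1 -[x *+ q]mulr_natl /y; ring.
  + rewrite big1 => [|i _]; last first.
      rewrite mxE /= /pineapple_adj /= /bump /= !add1n [(q + k < q)%N]ltnNge.
      by rewrite leq_addr /= !andbF mulr0.
    rewrite big1 => [|i _]; last first.
      rewrite mxE /= /pineapple_adj /= /bump /= !add1n [(q + k < q)%N]ltnNge.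
      by rewrite leq_addr /= !andbF mulr0.
    by rewrite vr mxE /= /pineapple_adj /= mulr1 !addr0.
Qed.

(** The polynomial [p] below is negative at [s] and nonnegative at [q + r]. *)
Lemma pineapple_spectral_radius (R : realType) q r (s : R) : (1 < q)%N ->
    q%:R <= s < q%:R + 1 -> s ^+ 2 = 'C(q.+1, 2)%:R + r%:R ->
  s < spectral_radius R (pineapple q r).
Proof.
move=> q1 /andP[qs sq] sE.
have q2 : 2 <= q%:R :> R by rewrite ler_nat.
have r0 : 0 <= r%:R :> R by [].
have binE : 'C(q.+1, 2)%:R * 2 = q%:R * (q%:R + 1) :> R.
  rewrite -natrM mulnC -mul_bin_diag bin1 natrM natr1 mulrC; ring.
set Q : R := q%:R in qs sq q2 binE; set t : R := r%:R in sE r0.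
pose p : {poly R} := 'X^2 * ('X - (Q - 1)%:P) - (Q *: 'X + t *: ('X - (Q - 1)%:P)).
have pE x : p.[x] = x ^+ 2 * (x - (Q - 1)) - (Q * x + t * (x - (Q - 1))).
  by rewrite /p !hornerE.
have ps : p.[s] < 0.
  have tE : t = s ^+ 2 - Q * (Q + 1) / 2 by lra.
  have -> : p.[s] = - (Q / 2 * ((Q - 1) * (Q + 1 - s))) by rewrite pE tE; field.
  by rewrite oppr_lt0; apply: mulr_gt0; [lra | apply: mulr_gt0; lra].
have pb : 0 <= p.[Q + t].
  have -> : p.[Q + t] = t * ((Q + t) ^+ 2 - t - 1 + (Q + t)) by rewrite pE; ring.
  apply: mulr_ge0 => //; nra.
have sb : s <= Q + t.
  rewrite -(@ler_pXn2r _ 2) ?nnegrE //; [nra | lra | lra].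
have [|x /andP[sx _] /rootP px] := @poly_ivt _ p s (Q + t) sb.
  by rewrite (ltW ps) pb.
have {}sx : s < x.
  by rewrite lt_neqAle sx andbT; apply/eqP => sxE; rewrite sxE px ltxx in ps.
apply: (lt_le_trans sx); apply: spectral_radius_ge; first by lra.
have morQ n : n%:R = (n%:R%:C)%C :> R[i] by rewrite rmorph_nat.
have one : 1 = (1%:C)%C :> R[i] by [].
apply: pineapple_eigenvalue.
  rewrite morQ one -!(rmorphB, rmorphM) /=.
  rewrite fmorph_eq0 mulf_neq0 //; apply/eqP; rewrite -/Q; lra.
rewrite !morQ one -rmorphXn.
rewrite -!(rmorphB, rmorphM, rmorphD) /=; congr (_%:C)%C.
by move: px; rewrite pE => /eqP; rewrite subr_eq0 => /eqP.
Qed.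

(** * Counting 4-cycles *)

Lemma cycle_edges4 n (a b c d : 'I_n) :
  cycle_edges [tuple a; b; c; d] =
    [set [set a; b]; [set b; c]; [set c; d]; [set d; a]]%SET.
Proof.
apply/setP => B; rewrite !inE; apply/imsetP/idP => [[i _ ->]|].
  by case: i => [[|[|[|[|]]]]] //= lti; rewrite !(tnth_nth a) /= eqxx ?orbT.
have E k (ltk : (k < 4)%N) : exists i : 'I_4, nat_of_ord i = k by exists (Ordinal ltk).
have [[[i0 E0] [i1 E1]] [[i2 E2] [i3 E3]]] := (E 0 isT, E 1 isT, (E 2 isT, E 3 isT)).
case/orP=> [/orP[/orP[]|]|] /eqP->; [exists i0|exists i1|exists i2|exists i3] => //;
  by rewrite !(tnth_nth a) /= ?E0 ?E1 ?E2 ?E3.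
Qed.

Lemma ucycleb4 n (G : sgraph n) (a b c d : 'I_n) :
  ucycleb G [tuple a; b; c; d] =
    [&& G a b, G b c, G c d, G d a & uniq [:: a; b; c; d]].
Proof. by rewrite /ucycleb /= andbT -!andbA. Qed.

(** Each copy of the 4-cycle comes from at least eight cyclic tuples, its
    rotations and their reversals. *)
Lemma C4_copies_le n (G : sgraph n) :
  (8 * #|C4_copies G| <= #|[set t : 4.-tuple 'I_n | ucycleb G t]%SET|)%N.
Proof.
rewrite /C4_copies -[leqRHS]sum1_card (partition_big_imset (@cycle_edges n)) /=.
rewrite mulnC -sum_nat_const; apply: leq_sum => B /imsetP[t tG BE].
rewrite sum1_card; move: tG; rewrite inE => tG.
pose P (u : 4.-tuple 'I_n) := ucycleb G u && (cycle_edges u == B).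
have P_rot a b c d : P [tuple a; b; c; d] -> P [tuple b; c; d; a].
  rewrite /P !cycle_edges4 !ucycleb4 => /andP[/and5P[-> -> -> -> abcd] /eqP<-] /=.
  apply/andP; split; first by rewrite -(rot_uniq 1) /= in abcd.
  by apply/eqP/setP => e; rewrite !inE; do 4![case: (e == _)].
have P_rev a b c d : P [tuple a; b; c; d] -> P [tuple d; c; b; a].
  rewrite /P !cycle_edges4 !ucycleb4 => /andP[/and5P[ab bc cd da abcd] /eqP<-].
  have setC2 (x y : 'I_n) : [set x; y]%SET = [set y; x]%SET by rewrite setUC.
  rewrite (adj_sym G d c) (adj_sym G c b) (adj_sym G b a) (adj_sym G a d).
  rewrite (setC2 d c) (setC2 c b) (setC2 b a) (setC2 a d) ab bc cd da /=.
  apply/andP; split; first by rewrite -rev_uniq in abcd.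
  by apply/eqP/setP => e; rewrite !inE; do 4![case: (e == _)].
have Pt : P t by rewrite /P tG BE eqxx.
case/tupleP: t Pt {tG BE} => a t; case/tupleP: t => b t; case/tupleP: t => c t.
case/tupleP: t => d t; rewrite (tuple0 t) => Pt.
have {}Pt : P [tuple a; b; c; d] by congr (P _): Pt; apply: val_inj.
pose s := [:: [tuple a; b; c; d]; [tuple b; c; d; a]; [tuple c; d; a; b];
  [tuple d; a; b; c]; [tuple d; c; b; a]; [tuple c; b; a; d];
  [tuple b; a; d; c]; [tuple a; d; c; b]].
have sP : all P s.
  have P2 := P_rot _ _ _ _ Pt; have P3 := P_rot _ _ _ _ P2.
  have P4 := P_rot _ _ _ _ P3.
  have R1 := P_rev _ _ _ _ Pt; have R2 := P_rev _ _ _ _ P2.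
  have R3 := P_rev _ _ _ _ P3; have R4 := P_rev _ _ _ _ P4.
  by clearbody P; rewrite /s /= Pt P2 P3 P4 R1 R2 R3 R4.
(* The eight tuples already differ in their first two entries. *)
have s_uniq : uniq s.
  apply: (@map_uniq _ _ (fun u : 4.-tuple 'I_n => (nth a u 0, nth a u 1))).
  case/andP: Pt; rewrite ucycleb4 => /and5P[_ _ _ _] + _.
  rewrite /= !inE !negb_or -!andbA => /and5P[ab ac ad bc /and3P[bd cd _]].
  rewrite !xpair_eqE ![b == a]eq_sym ![c == a]eq_sym ![d == a]eq_sym.
  rewrite ![c == b]eq_sym ![d == b]eq_sym ![d == c]eq_sym.
  rewrite (negbTE ab) (negbTE ac) (negbTE ad) (negbTE bc) (negbTE bd).
  by rewrite (negbTE cd) !(andbF, andFb, eqxx).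
have s8 : #|s| = 8%N by exact: (card_uniqP s_uniq).
apply: (@leq_trans #|s|); first by rewrite s8.
apply: subset_leq_card.
by apply/fintype.subsetP => u /(allP sP); rewrite unfold_in /= inE.
Qed.

Lemma C4_copies_pineapple q r :
  (8 * #|C4_copies (pineapple q r)| <= q.+1 ^_ 4)%N.
Proof.
apply: leq_trans (C4_copies_le _) _.
rewrite -(card_core q r) -card_uniq_tuples; apply: subset_leq_card.
apply/fintype.subsetP => t; rewrite !inE.
case/tupleP: t => a t; case/tupleP: t => b t; case/tupleP: t => c t.
case/tupleP: t => d t; rewrite (tuple0 t) /= => tG.
have {tG} : ucycleb (pineapple q r) [tuple a; b; c; d] by [].
rewrite ucycleb4 => /and5P[ab bc cd da abcd]; rewrite -/(uniq [:: a; b; c; d]) abcd.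
(* A vertex with two distinct neighbours is not pendant. *)
have in_core i j k : pineapple q r i j -> pineapple q r k i -> j != k ->
    i \in core q r.
  move=> ij ki; apply: contraR => ic; rewrite (pineapple_pendant ic ij).
  by rewrite adj_sym in ki; rewrite (pineapple_pendant ic ki).
move: abcd; rewrite /= !inE !negb_or -!andbA => /and5P[_ ac _ _ /and3P[bd _ _]].
apply/and5P; split=> //; first exact: in_core ab da bd.
- by apply: in_core bc ab _; rewrite eq_sym.
- by apply: in_core cd bc _; rewrite eq_sym.
- exact: in_core da cd ac.
Qed.

(** * The upper bound on f *)

Lemma is_f_le (R : realType) m k :
  C4_counts R m k -> exists2 fm : nat, is_f R m fm & (fm <= k)%N.
Proof.
move=> mk; have exk : exists l, boolp.asbool (C4_counts R m l).
  by exists k; apply/boolp.asboolP.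
case: (ex_minnP exk) => fm /boolp.asboolP fmP fm_min; exists fm.
  by split=> // l /boolp.asboolP; exact: fm_min.
by apply/fm_min/boolp.asboolP.
Qed.

Theorem proposition1 (R : realType) (m : nat) (hm : (4 <= m)%N) :
  exists2 fm : nat, is_f R m fm &
    fm%:R <= (m%:R - 1) * (m%:R - 2 * Num.sqrt (m%:R : R)) / 8.
Proof.
set s : R := Num.sqrt m%:R.
have s2 : s ^+ 2 = m%:R by rewrite sqr_sqrtr.
have le2s : 2 <= s by rewrite -(@ler_pXn2r _ 2) ?nnegrE ?sqrtr_ge0 // s2 -natrX ler_nat.
pose q := Num.truncn s.
have /andP[qs sq] : q%:R <= s < q%:R + 1 by rewrite natr1 Num.Theory.truncn_itv ?sqrtr_ge0.
have q1 : (1 < q)%N by rewrite Num.Theory.truncn_gt_nat.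
have q_m : (q ^ 2 <= m)%N by rewrite -(ler_nat R) natrX -s2 lerXn2r ?nnegrE //; lra.
have bin_m : ('C(q.+1, 2) <= m)%N.
  by rewrite bin2 /=; nia.
have Gm := card_edges_pineapple q (m - 'C(q.+1, 2)); rewrite subnKC // in Gm.
have sG : s < spectral_radius R (pineapple q (m - 'C(q.+1, 2))).
  by apply: pineapple_spectral_radius; rewrite ?q1 ?qs // -natrD subnKC.
have [|fm fmP le_fm] := @is_f_le R m #|C4_copies (pineapple q (m - 'C(q.+1, 2)))|.
  by exists _, (pineapple q (m - 'C(q.+1, 2))).
exists fm => //.
have : (8 * fm <= q.+1 ^_ 4)%N.
  apply: leq_trans (C4_copies_pineapple q (m - 'C(q.+1, 2))).
  by rewrite leq_mul2l; apply: le_fm.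
rewrite -(ler_nat R) natrM => le8.
rewrite ler_pdivlMr // mulrC (le_trans le8) // -s2.
(* Both sides factor, and each factor on the left, an expression in [q], is
   bounded by the same expression in [s]. *)
rewrite !ffactnSr ffactn0 mul1n subn0 !subSS subn0 -!mulnA.
have q2 : 2 <= q%:R :> R by rewrite ler_nat.
rewrite !natrM !natrB ?(ltnW q1) // -natr1.
have -> : (s ^+ 2 - 1) * (s ^+ 2 - 2 * s) = (s + 1) * (s * ((s - 1) * (s - 2))).
  by ring.
by rewrite !ler_pM ?mulr_ge0 //; lra.
Qed.
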